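(* Let $\mathcal{D}$ be a qualification domain expressible in a constraint domain $\mathcal{C}$, and let $\mathcal{P}$ be a $\mathrm{QCFLP}(\mathcal{D},\mathcal{C})$-program, with least model $S_{\mathcal{P}}$. For any qc-statement $\varphi$, the following three conditions are equivalent: (a) $\mathcal{P} \vdash_{\mathcal{D},\mathcal{C}} \varphi$ (derivability in the rewriting logic $\mathrm{QCRWL}(\mathcal{D},\mathcal{C})$); (b) $\mathcal{P} \models_{\mathcal{D},\mathcal{C}} \varphi$ (semantic consequence); (c) $S_{\mathcal{P}} \Vdash_{\mathcal{D},\mathcal{C}} \varphi$ (derivability from the qc-interpretation $S_{\mathcal{P}}$ in $\mathcal{I}\text{-}\mathrm{QCRWL}(\mathcal{D},\mathcal{C})$). Moreover: 1. (Soundness) for any qc-statement $\varphi$, $\mathcal{P} \vdash_{\mathcal{D},\mathcal{C}} \varphi$ implies $\mathcal{P} \models_{\mathcal{D},\mathcal{C}} \varphi$; 2. (Completeness) for any qc-statement $\varphi$, $\mathcal{P} \models_{\mathcal{D},\mathcal{C}} \varphi$ implies $\mathcal{P} \vdash_{\mathcal{D},\mathcal{C}} \varphi$; 3. (Canonicity) $S_{\mathcal{P}} = \{\varphi \mid \varphi \text{ is a qc-fact and } \mathcal{P} \vdash_{\mathcal{D},\mathcal{C}} \varphi\}$.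
   Context: **Qualification domain.** $\mathcal{D} = \langle D, \trianglelefteq, \mathbf{b}, \mathbf{t}, \circ\rangle$ where $\langle D,\trianglelefteq,\mathbf b,\mathbf t\rangle$ is a lattice with bottom $\mathbf b$, top $\mathbf t$, meet $\sqcap$, and $\circ: D\times D\to D$ satisfies: $\circ$ is associative, commutative and monotonic w.r.t. $\trianglelefteq$; $d\circ \mathbf t = d$ for all $d$; $d\circ e \trianglelefteq e$ and $d\circ e\neq e$ for all $d,e\in D\setminus\{\mathbf b,\mathbf t\}$; $d\circ(e_1\sqcap e_2) = (d\circ e_1)\sqcap(d\circ e_2)$. **Syntax.** A signature $\Sigma=\langle DC,PF,DF\rangle$ consists of mutually disjoint sets of data constructors, primitive function symbols and defined function symbols, ranked by arities ($DC^n$, $PF^n$, $DF^n$); it includes $true,false\in DC^0$ and the infix symbol $==\ \in PF^2$. Given a set $B$ of basic values and a countably infinite set $\mathcal V\!ar$ of variables: expressions are $e::=\bot\mid X\mid u\mid h(e_1,\dots,e_n)$ with $X\in\mathcal V\!ar$, $u\in B$, $h\in DC^n\cup PF^n\cup DF^n$; terms are $t::=\bot\mid X\mid u\mid c(t_1,\dots,t_n)$ with $c\in DC^n$. An expression or term is total if it has no occurrence of $\bot$, ground if it has no variables. The information ordering $\sqsubseteq$ is the least partial order on expressions compatible with contexts such that $\bot\sqsubseteq e$ for all $e$. Substitutions map variables to (possibly partial) terms; $o\sigma$ is the result of applying $\sigma$ to $o$; $\mathrm{vdom}(\sigma)$ is the domain of $\sigma$. **Constraint domain.** $\mathcal C=\langle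 C,\{p^{\mathcal C}\mid p\in PF\}\rangle$ of signature $\Sigma$: $C$ is the set of ground terms over some set $B=B_{\mathcal C}$ of basic values; for $p\in PF^n$, $p^{\mathcal C}\subseteq C^n\times C$, written $p^{\mathcal C}(\overline t_n)\to t$. Monotonicity: if $p^{\mathcal C}(\overline t_n)\to t$, $t_i\sqsubseteq t_i'$ for all $i$ and $t\sqsupseteq t'$, then $p^{\mathcal C}(\overline{t'}_n)\to t'$. Radicality: if $p^{\mathcal C}(\overline t_n)\to t$ then $t=\bot$ or $t\in B\cup DC^0$. The symbol $==$ is interpreted as strict equality: $(t_1 ==^{\mathcal C} t_2)\to t$ iff $t=\bot$, or $t=true$ and $t_1=t_2$ is total, or $t=false$ and $t_1,t_2$ have no common upper bound w.r.t. $\sqsubseteq$. **Constraints.** Atomic constraints have the form $p(\overline e_n)==v$ with $p\in PF^n$, $e_i$ expressions, $v\in\mathcal V\!ar\cup DC^0\cup B_{\mathcal C}$; they are primitive if no $DF$ symbol occurs. For ground expressions without $DF$ symbols define $e\rightsquigarrow t$ ($t\in C$) inductively: $e\rightsquigarrow\bot$; $u\rightsquigarrow u$ for $u\in B$; $c(\overline e_n)\rightsquigarrow c(\overline t_n)$ if all $e_i\rightsquigarrow t_i$; $p(\overline e_n)\rightsquigarrow t$ if all $e_i\rightsquigarrow t_i$ and $p^{\mathcal C}(\overline t_n)\to t$. A ground primitive $p(\overline e_n)==t$ is true iff $t$ is total and $p(\overline e_n)\rightsquigarrow t$. A valuation is a substitution $\eta$ with $X\eta\in C$ for all $X\in\mathrm{vdom}(\eta)$.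 For a set $\Pi$ of primitive constraints (read as a conjunction), $\mathrm{Sol}_{\mathcal C}(\Pi)$ is the set of valuations $\eta$ such that $\pi\eta$ is ground and true for all $\pi\in\Pi$; $\mathrm{Unsat}_{\mathcal C}(\Pi)$ means $\mathrm{Sol}_{\mathcal C}(\Pi)=\emptyset$; $\Pi\models_{\mathcal C}\Pi'$ means every valuation defined on all variables involved that solves $\Pi$ solves every member of $\Pi'$; $\Pi\models_{\mathcal C}p(\overline t_n)\to v$ means that $p^{\mathcal C}(\overline t_n\eta)\to v\eta$ for every such solution $\eta$ of $\Pi$. **Expressibility.** $\mathcal D$ is expressible in $\mathcal C$ if $D\setminus\{\mathbf b\}\subseteq C$ and there are primitive $\mathcal C$-constraints $\mathsf{qVal}(X)$, whose solutions are exactly the valuations $\eta$ with $\eta(X)\in D\setminus\{\mathbf b\}$, and $\mathsf{qBound}(X,Y,Z)$ such that for all $\eta$ with $\eta(X),\eta(Y),\eta(Z)\in D\setminus\{\mathbf b\}$: $\eta$ solves it iff $\eta(X)\trianglelefteq\eta(Y)\circ\eta(Z)$. **Programs.** A $\mathrm{QCFLP}(\mathcal D,\mathcal C)$-program is a set of rules $f(\overline t_n)\xrightarrow{\alpha} r\Leftarrow\delta_1,\dots,\delta_m$ with $f\in DF^n$, $\overline t_n$ a linear tuple of terms (no variable occurs twice), $\alpha\in D\setminus\{\mathbf b\}$, $r$ an expression, $\delta_j$ atomic constraints, and no occurrence of $\bot$. **qc-statements.** With $d\in D\setminus\{\mathbf b\}$ and $\Pi$ a finite set of atomic primitive constraints: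 qc-productions $(e\to t)\sharp d\Leftarrow\Pi$ ($e$ expression, $t$ term; trivial iff $t=\bot$ or $\mathrm{Unsat}_{\mathcal C}(\Pi)$) and qc-atoms $\delta\sharp d\Leftarrow\Pi$ ($\delta$ atomic constraint; trivial iff $\mathrm{Unsat}_{\mathcal C}(\Pi)$). qc-facts are the qc-productions $(f(\overline t_n)\to t)\sharp d\Leftarrow\Pi$ with $f\in DF^n$ and $t_i$ terms. **Entailment.** $\varphi\succcurlyeq_{\mathcal D,\mathcal C}\varphi'$ iff either $\varphi=(e\to t)\sharp d\Leftarrow\Pi$, $\varphi'=(e'\to t')\sharp d'\Leftarrow\Pi'$ and some substitution $\sigma$ satisfies $\Pi'\models_{\mathcal C}\Pi\sigma$, $d'\trianglelefteq d$, $e\sigma\sqsubseteq e'$, $t\sigma\sqsupseteq t'$; or $\varphi=\delta\sharp d\Leftarrow\Pi$, $\varphi'=\delta'\sharp d'\Leftarrow\Pi'$ and some $\sigma$ satisfies $\Pi'\models_{\mathcal C}\Pi\sigma$, $d'\trianglelefteq d$, $\delta\sigma\sqsubseteq\delta'$ (componentwise). **qc-interpretations.** Sets $\mathcal I$ of qc-facts containing all trivial qc-facts and every qc-fact entailed by a member of $\mathcal I$. **Logic $\mathcal I$-$\mathrm{QCRWL}(\mathcal D,\mathcal C)$.** $\mathcal I\Vdash_{\mathcal D,\mathcal C}\varphi$ means $\varphi$ is derivable by the following rules (all $d$'s in $D\setminus\{\mathbf b\}$), where a trivial statement can be inferred only by QTI: - QTI: infer any trivial $\varphi$. - QRR: infer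 $(v\to v)\sharp d\Leftarrow\Pi$ if $v\in\mathcal V\!ar\cup B_{\mathcal C}$. - QDC: from $(e_i\to t_i)\sharp d_i\Leftarrow\Pi$ ($1\le i\le n$) infer $(c(\overline e_n)\to c(\overline t_n))\sharp d\Leftarrow\Pi$ if $c\in DC^n$, $d\trianglelefteq d_i$ for all $i$. - QDF$_{\mathcal I}$: from $(e_i\to t_i)\sharp d_i\Leftarrow\Pi$ ($1\le i\le n$) infer $(f(\overline e_n)\to t)\sharp d\Leftarrow\Pi$ if $f\in DF^n$, some non-trivial $((f(\overline t_n)\to t)\sharp d_0\Leftarrow\Pi)\in\mathcal I$, and $d\trianglelefteq d_i$ ($0\le i\le n$). - QPF: from $(e_i\to t_i)\sharp d_i\Leftarrow\Pi$ ($1\le i\le n$) infer $(p(\overline e_n)\to v)\sharp d\Leftarrow\Pi$ if $p\in PF^n$, $v\in\mathcal V\!ar\cup DC^0\cup B_{\mathcal C}$, $\Pi\models_{\mathcal C}p(\overline t_n)\to v$, $d\trianglelefteq d_i$ for all $i$. - QAC: from the same premises infer $(p(\overline e_n)==v)\sharp d\Leftarrow\Pi$ if $p\in PF^n$, $v\in\mathcal V\!ar\cup DC^0\cup B_{\mathcal C}$, $\Pi\models_{\mathcal C}p(\overline t_n)==v$, $d\trianglelefteq d_i$ for all $i$. **Models and consequence.** $\mathcal I$ is a model of a rule $f(\overline t_n)\xrightarrow{\alpha}r\Leftarrow\delta_1,\dots,\delta_m$ iff for every substitution $\theta$, every finite set $\Pi$ of atomic primitive constraints, every term $t$ and all $d,d_0,\dots,d_m\in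 D\setminus\{\mathbf b\}$ such that $\mathcal I\Vdash_{\mathcal D,\mathcal C}\delta_i\theta\sharp d_i\Leftarrow\Pi$ ($1\le i\le m$), $\mathcal I\Vdash_{\mathcal D,\mathcal C}(r\theta\to t)\sharp d_0\Leftarrow\Pi$ and $d\trianglelefteq\alpha\circ d_i$ ($0\le i\le m$), one has $((f(\overline t_n)\theta\to t)\sharp d\Leftarrow\Pi)\in\mathcal I$. $\mathcal I$ is a model of $\mathcal P$ iff it is a model of every rule of $\mathcal P$. $\mathcal P\models_{\mathcal D,\mathcal C}\varphi$ iff $\mathcal I\Vdash_{\mathcal D,\mathcal C}\varphi$ for every model $\mathcal I$ of $\mathcal P$. $S_{\mathcal P}$ denotes the least model of $\mathcal P$ w.r.t. set inclusion (it exists). **Logic $\mathrm{QCRWL}(\mathcal D,\mathcal C)$.** $\mathcal P\vdash_{\mathcal D,\mathcal C}\varphi$ means $\varphi$ is derivable with the rules QTI, QRR, QDC, QPF, QAC above (same convention on QTI), and, in place of QDF$_{\mathcal I}$, the rule QDF$_{\mathcal P}$: from $(e_i\to t_i)\sharp d_i\Leftarrow\Pi$ ($1\le i\le n$), $(r\to t)\sharp d_0'\Leftarrow\Pi$ and $\delta_j\sharp d_j'\Leftarrow\Pi$ ($1\le j\le m$) infer $(f(\overline e_n)\to t)\sharp d\Leftarrow\Pi$, if $f\in DF^n$, $(f(\overline t_n)\xrightarrow{\alpha}r\Leftarrow\delta_1,\dots,\delta_m)\in[\mathcal P]_\bot=\{R\theta\mid R\in\mathcal P,\ \theta\text{ a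 substitution}\}$, $d\trianglelefteq d_i$ ($1\le i\le n$) and $d\trianglelefteq\alpha\circ d_j'$ ($0\le j\le m$). *)

(* Defs.v *)
From Stdlib Require Eqdep_dec PeanoNat.
From mathcomp Require Import all_boot all_order.
From mathcomp Require Import boolp classical_sets functions cardinality.

Set Implicit Arguments.
Unset Strict Implicit.
Unset Printing Implicit Defensive.

Import Order.TTheory.
Local Open Scope classical_set_scope.

Record qdomain (disp : Order.disp_t) := QDomain {
  qcarrier :> tbLatticeType disp;
  qop : qcarrier -> qcarrier -> qcarrier;
  qopA : associative qop;
  qopC : commutative qop;
  qop_mono : forall d d' e e',
    (d <= d')%O -> (e <= e')%O -> (qop d e <= qop d' e')%O;
  qopT : forall d, qop d \top%O = d;
  qop_lt : forall d e, d != \bot%O -> d != \top%O -> e != \bot%O ->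
    e != \top%O -> (qop d e <= e)%O /\ qop d e <> e;
  qop_meet : forall d e1 e2,
    qop d (Order.meet e1 e2) = Order.meet (qop d e1) (qop d e2)
}.

(* Ranked symbols are families indexed by the arity, so that [DC S n] is DC^n.
   Distinct types make the three kinds of symbols mutually disjoint. *)
Record signature := Signature {
  DC : nat -> Type;
  PF : nat -> Type;
  DF : nat -> Type;
  sym_true : DC 0;
  sym_false : DC 0;
  sym_true_neq_false : sym_true <> sym_false;
  sym_eq : PF 2
}.

Inductive symbol (S : signature) (n : nat) :=
  | Scon of DC S n
  | Spri of PF S n
  | Sdef of DF S n.
Arguments Scon {S n} c.
Arguments Spri {S n} p.
Arguments Sdef {S n} f.

(* An n-tuple of expressions is a function on 'I_n; functional extensionality
   (boolp) makes equality of tuples componentwise. *)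
Inductive expr (S : signature) (V : countType) (B : Type) :=
  | Bot
  | EVar of V
  | EBas of B
  | App n of symbol S n & ('I_n -> expr S V B).
Arguments Bot {S V B}.
Arguments EVar {S V B} X.
Arguments EBas {S V B} u.
Arguments App {S V B n} h e.

Notation con c e := (App (Scon c) e).
Notation pri p e := (App (Spri p) e).
Notation def f e := (App (Sdef f) e).

Section Syntax.
Context {S : signature} {V : countType} {B : Type}.
Local Notation expr := (expr S V B).

(* All tuples 'I_0 -> expr are equal, so this is the unique expression with
   root [c]. *)
Definition cst (c : DC S 0) : expr := con c (fun=> Bot).

Fixpoint is_term (e : expr) : Prop :=
  match e with
  | Bot | EVar _ | EBas _ => True
  | App n h e' =>
      match h with
      | Scon _ => forall i, is_term (e' i)
      | Spri _ | Sdef _ => False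
      end
  end.

Fixpoint no_def (e : expr) : Prop :=
  match e with
  | Bot | EVar _ | EBas _ => True
  | App n h e' =>
      match h with
      | Scon _ | Spri _ => forall i, no_def (e' i)
      | Sdef _ => False
      end
  end.

Fixpoint is_total (e : expr) : Prop :=
  match e with
  | Bot => False
  | EVar _ | EBas _ => True
  | App n _ e' => forall i, is_total (e' i)
  end.

(* Variable occurrences, with multiplicity. *)
Fixpoint vars (e : expr) : seq V :=
  match e with
  | Bot | EBas _ => [::]
  | EVar X => [:: X]
  | App n _ e' => flatten [seq vars (e' i) | i <- enum 'I_n]
  end.

Definition ground (e : expr) : Prop := vars e = [::].

Definition linear_tuple n (t : 'I_n -> expr) : Prop :=
  uniq (flatten [seq vars (t i) | i <- enum 'I_n]).

(* Compatibility with contexts is stated for all arguments at once; by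
   reflexivity and transitivity this amounts to one-hole contexts.
   Antisymmetry is not imposed: it is the lemma [ile_anti] below. *)
Inductive ile : expr -> expr -> Prop :=
  | ile_bot e : ile Bot e
  | ile_refl e : ile e e
  | ile_trans e1 e2 e3 : ile e1 e2 -> ile e2 e3 -> ile e1 e3
  | ile_app n (h : symbol S n) (e e' : 'I_n -> expr) :
      (forall i, ile (e i) (e' i)) -> ile (App h e) (App h e').

Fixpoint esubst (s : V -> expr) (e : expr) : expr :=
  match e with
  | Bot => Bot
  | EVar X => s X
  | EBas u => EBas u
  | App n h e' => App h (fun i => esubst s (e' i))
  end.

Definition substitution (s : V -> expr) : Prop := forall X, is_term (s X).

Definition vdom (s : V -> expr) : set V := [set X | s X <> EVar X].

(* The carrier C of a constraint domain over B. *)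
Definition gterm : set expr := [set t | is_term t /\ ground t].

Record cdomain := CDomain {
  interp : forall n, PF S n -> ('I_n -> expr) -> expr -> Prop;
  interp_sub : forall n (p : PF S n) t v,
    interp p t v -> (forall i, gterm (t i)) /\ gterm v;
  interp_mono : forall n (p : PF S n) t t' v v',
    (forall i, gterm (t' i)) -> gterm v' ->
    interp p t v -> (forall i, ile (t i) (t' i)) -> ile v' v ->
    interp p t' v';
  interp_radical : forall n (p : PF S n) t v,
    interp p t v ->
    [\/ v = Bot, exists u, v = EBas u | exists c, v = cst c];
  interp_eq : forall t v, (forall i, gterm (t i)) -> gterm v ->
    interp (sym_eq S) t v <->
    [\/ v = Bot,
        [/\ v = cst (sym_true S), t ord0 = t ord_max & is_total (t ord0)]
      | v = cst (sym_false S) /\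
        ~ exists w, [/\ gterm w, ile (t ord0) w & ile (t ord_max) w]]
}.

(* Raw constraints [p(e_1,...,e_n) == v] with an arbitrary right-hand side:
   an instance of an atomic constraint need not be atomic. *)
Record constraint := Constr {
  car : nat;
  cprim : PF S car;
  cargs : 'I_car -> expr;
  crhs : expr
}.
Arguments cprim : clear implicits.
Arguments cargs : clear implicits.
Arguments crhs : clear implicits.

Inductive simple : expr -> Prop :=
  | simple_var X : simple (EVar X)
  | simple_bas u : simple (EBas u)
  | simple_cst c : simple (cst c).

Definition atomic (pi : constraint) : Prop := simple (crhs pi).

Definition primitive (pi : constraint) : Prop :=
  (forall i, no_def (cargs pi i)) /\ no_def (crhs pi).

Definition csubst (s : V -> expr) (pi : constraint) : constraint :=
  Constr (cprim pi) (fun i => esubst s (cargs pi i)) (esubst s (crhs pi)).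

Definition cvars (pi : constraint) : set V :=
  [set X | (exists i, X \in vars (cargs pi i)) \/ X \in vars (crhs pi)].

Definition csvars (Pi : set constraint) : set V :=
  \bigcup_(pi in Pi) cvars pi.

Definition cground (pi : constraint) : Prop := cvars pi = set0.

Definition ctotal (pi : constraint) : Prop :=
  (forall i, is_total (cargs pi i)) /\ is_total (crhs pi).

Inductive cle : constraint -> constraint -> Prop :=
  | cle_intro n (p : PF S n) e e' v v' :
      (forall i, ile (e i) (e' i)) -> ile v v' ->
      cle (Constr p e v) (Constr p e' v').

Definition valuation (eta : V -> expr) : Prop :=
  substitution eta /\ forall X, vdom eta X -> gterm (eta X).

Section Constraints.
Variable C : cdomain.

(* Relates ground expressions without defined symbols to ground terms. *)
Inductive reduces : expr -> expr -> Prop :=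
  | red_bot e : ground e -> no_def e -> reduces e Bot
  | red_bas u : reduces (EBas u) (EBas u)
  | red_con n (c : DC S n) e t :
      (forall i, reduces (e i) (t i)) -> reduces (con c e) (con c t)
  | red_pri n (p : PF S n) e t v :
      (forall i, reduces (e i) (t i)) -> interp C p t v ->
      reduces (pri p e) v.

Definition holds (pi : constraint) : Prop :=
  is_total (crhs pi) /\ reduces (pri (cprim pi) (cargs pi)) (crhs pi).

Definition Sol (Pi : set constraint) : set (V -> expr) :=
  [set eta | valuation eta /\
    forall pi, Pi pi -> cground (csubst eta pi) /\ holds (csubst eta pi)].

Definition Unsat (Pi : set constraint) : Prop := Sol Pi = set0.

Definition models_cs (Pi Pi' : set constraint) : Prop :=
  forall eta, valuation eta -> csvars Pi `|` csvars Pi' `<=` vdom eta ->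
    Sol Pi eta -> forall pi, Pi' pi -> Sol [set pi] eta.

(* Pi |= p(t_1,...,t_n) -> v *)
Definition models_prod (Pi : set constraint) n (p : PF S n)
    (t : 'I_n -> expr) (v : expr) : Prop :=
  forall eta, valuation eta -> csvars Pi `|` cvars (Constr p t v) `<=` vdom eta ->
    Sol Pi eta -> interp C p (fun i => esubst eta (t i)) (esubst eta v).

Definition constraint_set (Pi : set constraint) : Prop :=
  finite_set Pi /\ forall pi, Pi pi -> atomic pi /\ primitive pi.

End Constraints.

End Syntax.

Arguments expr S V B : clear implicits.
Arguments cdomain S V B : clear implicits.
Arguments constraint S V B : clear implicits.
Arguments cprim {S V B} c : rename.
Arguments cargs {S V B} c i : rename.
Arguments crhs {S V B} c : rename.

(* The inclusion of D \ {b} in C is an embedding [emb]; qVal(X) and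
   qBound(X,Y,Z) may be conjunctions of atomic primitive constraints. *)
Definition expressible disp (D : qdomain disp) S V B (C : cdomain S V B) :
    Prop :=
  exists emb : D -> expr S V B,
  [/\ forall d d', d != \bot%O -> d' != \bot%O -> emb d = emb d' -> d = d',
      forall d, d != \bot%O -> gterm (emb d),
      forall X, exists Q : set (constraint S V B),
        [/\ constraint_set Q, csvars Q `<=` [set X] &
            forall eta, valuation eta ->
              Sol C Q eta <-> exists2 d, d != \bot%O & eta X = emb d]
    & forall X Y Z, exists Q : set (constraint S V B),
        [/\ constraint_set Q, csvars Q `<=` [set X; Y; Z] &
            forall eta x y z, valuation eta ->
              x != \bot%O -> y != \bot%O -> z != \bot%O ->
              eta X = emb x -> eta Y = emb y -> eta Z = emb z ->
              Sol C Q eta <-> (x <= qop y z)%O]].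

Section Programs.
Context {disp : Order.disp_t} (D : qdomain disp).
Context (S : signature) (V : countType) (B : Type).
Local Notation expr := (expr S V B).
Local Notation constraint := (constraint S V B).

(* f(t_1,...,t_n) --alpha--> r <= delta_1,...,delta_m *)
Record rule := Rule {
  rar : nat;
  rfun : DF S rar;
  rlhs : 'I_rar -> expr;
  ratt : D;
  rrhs : expr;
  rlen : nat;
  rcond : 'I_rlen -> constraint
}.
Arguments rfun : clear implicits.
Arguments rlhs : clear implicits.
Arguments rcond : clear implicits.

Definition valid_rule (R : rule) : Prop :=
  [/\ forall i, is_term (rlhs R i) /\ is_total (rlhs R i),
      linear_tuple (rlhs R),
      ratt R != \bot%O,
      is_total (rrhs R)
    & forall j, atomic (rcond R j) /\ ctotal (rcond R j)].

Definition program (P : set rule) : Prop := forall R, P R -> valid_rule R.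

Definition rsubst (s : V -> expr) (R : rule) : rule :=
  Rule (rfun R) (fun i => esubst s (rlhs R i)) (ratt R) (esubst s (rrhs R))
       (fun j => csubst s (rcond R j)).

(* [P]_bot *)
Definition instances (P : set rule) : set rule :=
  [set R' | exists R s, [/\ P R, substitution s & R' = rsubst s R]].

(* Raw statements (e -> t)#d <= Pi and delta#d <= Pi; those meeting the
   side conditions are singled out by [qc_statement]. *)
Inductive statement :=
  | Prod of expr & expr & D & set constraint
  | Atom of constraint & D & set constraint.

Definition qc_statement (phi : statement) : Prop :=
  match phi with
  | Prod _ t d Pi => [/\ is_term t, d != \bot%O & constraint_set Pi]
  | Atom delta d Pi => [/\ atomic delta, d != \bot%O & constraint_set Pi]
  end.

Definition qc_fact (phi : statement) : Prop :=
  qc_statement phi /\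
  exists n (f : DF S n) t t' d Pi,
    phi = Prod (def f t) t' d Pi /\ forall i, is_term (t i).

Variable C : cdomain S V B.

Definition trivial_stmt (phi : statement) : Prop :=
  match phi with
  | Prod _ t _ Pi => t = Bot \/ Unsat C Pi
  | Atom _ _ Pi => Unsat C Pi
  end.

Definition nontrivial (phi : statement) : Prop :=
  qc_statement phi /\ ~ trivial_stmt phi.

Definition entails (phi phi' : statement) : Prop :=
  match phi, phi' with
  | Prod e t d Pi, Prod e' t' d' Pi' =>
      exists s, [/\ substitution s, models_cs C Pi' (csubst s @` Pi),
                    (d' <= d)%O, ile (esubst s e) e' & ile t' (esubst s t)]
  | Atom delta d Pi, Atom delta' d' Pi' =>
      exists s, [/\ substitution s, models_cs C Pi' (csubst s @` Pi),
                    (d' <= d)%O & cle (csubst s delta) delta']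
  | _, _ => False
  end.

Definition qc_interpretation (I : set statement) : Prop :=
  [/\ I `<=` qc_fact,
      forall phi, qc_fact phi -> trivial_stmt phi -> I phi
    & forall phi phi', I phi -> qc_fact phi' -> entails phi phi' -> I phi'].

(* I-QCRWL. The [nontrivial] premises say that the conclusion is a qc-statement
   (in particular d <> b) which only QTI could infer if it were trivial. *)
Inductive iderives (I : set statement) : statement -> Prop :=
  | IQTI phi : qc_statement phi -> trivial_stmt phi -> iderives I phi
  | IQRR_var X d Pi : nontrivial (Prod (EVar X) (EVar X) d Pi) ->
      iderives I (Prod (EVar X) (EVar X) d Pi)
  | IQRR_bas u d Pi : nontrivial (Prod (EBas u) (EBas u) d Pi) ->
      iderives I (Prod (EBas u) (EBas u) d Pi)
  | IQDC n (c : DC S n) e t ds d Pi :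
      nontrivial (Prod (con c e) (con c t) d Pi) ->
      (forall i, iderives I (Prod (e i) (t i) (ds i) Pi)) ->
      (forall i, d <= ds i)%O ->
      iderives I (Prod (con c e) (con c t) d Pi)
  | IQDF n (f : DF S n) e t t' d0 ds d Pi :
      nontrivial (Prod (def f e) t' d Pi) ->
      (forall i, iderives I (Prod (e i) (t i) (ds i) Pi)) ->
      I (Prod (def f t) t' d0 Pi) -> nontrivial (Prod (def f t) t' d0 Pi) ->
      (d <= d0)%O -> (forall i, d <= ds i)%O ->
      iderives I (Prod (def f e) t' d Pi)
  | IQPF n (p : PF S n) e t v ds d Pi :
      nontrivial (Prod (pri p e) v d Pi) ->
      (forall i, iderives I (Prod (e i) (t i) (ds i) Pi)) ->
      simple v -> models_prod C Pi p t v ->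
      (forall i, d <= ds i)%O ->
      iderives I (Prod (pri p e) v d Pi)
  | IQAC n (p : PF S n) e t v ds d Pi :
      nontrivial (Atom (Constr p e v) d Pi) ->
      (forall i, iderives I (Prod (e i) (t i) (ds i) Pi)) ->
      simple v -> models_cs C Pi [set Constr p t v] ->
      (forall i, d <= ds i)%O ->
      iderives I (Atom (Constr p e v) d Pi).

Definition model_rule (I : set statement) (R : rule) : Prop :=
  forall s Pi t d d0 (ds : 'I_(rlen R) -> D),
    substitution s -> constraint_set Pi -> is_term t ->
    d != \bot%O -> d0 != \bot%O -> (forall j, ds j != \bot%O) ->
    (forall j, iderives I (Atom (csubst s (rcond R j)) (ds j) Pi)) ->
    iderives I (Prod (esubst s (rrhs R)) t d0 Pi) ->
    (d <= qop (ratt R) d0)%O -> (forall j, d <= qop (ratt R) (ds j))%O ->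
    I (Prod (def (rfun R) (fun i => esubst s (rlhs R i))) t d Pi).

Definition model (P : set rule) (I : set statement) : Prop :=
  qc_interpretation I /\ forall R, P R -> model_rule I R.

Definition least_model (P : set rule) (I : set statement) : Prop :=
  model P I /\ forall J, model P J -> I `<=` J.

Definition consequence (P : set rule) (phi : statement) : Prop :=
  forall I, model P I -> iderives I phi.

(* QCRWL; same convention on trivial statements. *)
Inductive derives (P : set rule) : statement -> Prop :=
  | QTI phi : qc_statement phi -> trivial_stmt phi -> derives P phi
  | QRR_var X d Pi : nontrivial (Prod (EVar X) (EVar X) d Pi) ->
      derives P (Prod (EVar X) (EVar X) d Pi)
  | QRR_bas u d Pi : nontrivial (Prod (EBas u) (EBas u) d Pi) ->
      derives P (Prod (EBas u) (EBas u) d Pi)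
  | QDC n (c : DC S n) e t ds d Pi :
      nontrivial (Prod (con c e) (con c t) d Pi) ->
      (forall i, derives P (Prod (e i) (t i) (ds i) Pi)) ->
      (forall i, d <= ds i)%O ->
      derives P (Prod (con c e) (con c t) d Pi)
  | QDF n (f : DF S n) e t t' alpha r m (delta : 'I_m -> constraint)
        ds d0' ds' d Pi :
      nontrivial (Prod (def f e) t' d Pi) ->
      (forall i, derives P (Prod (e i) (t i) (ds i) Pi)) ->
      derives P (Prod r t' d0' Pi) ->
      (forall j, derives P (Atom (delta j) (ds' j) Pi)) ->
      instances P (Rule f t alpha r delta) ->
      (forall i, d <= ds i)%O ->
      (d <= qop alpha d0')%O -> (forall j, d <= qop alpha (ds' j))%O ->
      derives P (Prod (def f e) t' d Pi)
  | QPF n (p : PF S n) e t v ds d Pi :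
      nontrivial (Prod (pri p e) v d Pi) ->
      (forall i, derives P (Prod (e i) (t i) (ds i) Pi)) ->
      simple v -> models_prod C Pi p t v ->
      (forall i, d <= ds i)%O ->
      derives P (Prod (pri p e) v d Pi)
  | QAC n (p : PF S n) e t v ds d Pi :
      nontrivial (Atom (Constr p e v) d Pi) ->
      (forall i, derives P (Prod (e i) (t i) (ds i) Pi)) ->
      simple v -> models_cs C Pi [set Constr p t v] ->
      (forall i, d <= ds i)%O ->
      derives P (Atom (Constr p e v) d Pi).

End Programs.

Arguments statement {disp} D S V B.
Arguments rule {disp} D S V B.
Arguments rfun {disp D S V B} r : rename.
Arguments rlhs {disp D S V B} r i : rename.
Arguments rcond {disp D S V B} r j : rename.

Section Facts.
Context {S : signature} {V : countType} {B : Type}.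
Local Notation expr := (expr S V B).

Let App_inj n (h h' : symbol S n) (e e' : 'I_n -> expr) :
  App h e = App h' e' -> h = h' /\ e = e'.
Proof.
case=> Eh Ee; split.
- exact: (Eqdep_dec.inj_pair2_eq_dec _ PeanoNat.Nat.eq_dec _ _ _ _ Eh).
- exact: (Eqdep_dec.inj_pair2_eq_dec _ PeanoNat.Nat.eq_dec _ _ _ _ Ee).
Qed.

Lemma ile_inv (e e' : expr) : ile e e' ->
  match e with
  | Bot => True
  | EVar _ | EBas _ => e' = e
  | App n h a => exists2 b, e' = App h b & forall i, ile (a i) (b i)
  end.
Proof.
elim=> {e e'} [e|e|e1 e2 e3 le12 IH12 le23 IH23|n h a b le _] //.
- by case: e => // n h a; exists a => // i; exact: ile_refl.
- case: e1 IH12 {le12} => [|X|u|n h a] //= => [E|E|[b E leab]].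
  + by rewrite E in IH23; exact: IH23.
  + by rewrite E in IH23; exact: IH23.
  + rewrite E in IH23; case: IH23 => c -> lebc; exists c => // i.
    exact: ile_trans (leab i) (lebc i).
- by exists b.
Qed.

Lemma ile_anti (e e' : expr) : ile e e' -> ile e' e -> e = e'.
Proof.
elim: e e' => [|X|u|n h a IH] e' /ile_inv //.
- by case: e' => [|X|u|n h a] // _ /ile_inv // [].
- case=> b -> leab /ile_inv[c /App_inj[_ E] leba].
  congr App; apply: funext => i; apply: IH; first exact: leab.
  by rewrite E; exact: leba.
Qed.

Context {disp : Order.disp_t} (D : qdomain disp) (C : cdomain S V B).

Lemma iderives_mono (I J : set (statement D S V B)) phi :
  I `<=` J -> iderives C I phi -> iderives C J phi.
Proof.
move=> IJ; elim=> {phi}.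
- by move=> *; exact: IQTI.
- by move=> *; exact: IQRR_var.
- by move=> *; exact: IQRR_bas.
- by move=> *; apply: IQDC; eassumption.
- by move=> n f e t t' d0 ds d Pi ? _ ? /IJ *; apply: IQDF; eassumption.
- by move=> *; apply: IQPF; eassumption.
- by move=> *; apply: IQAC; eassumption.
Qed.

Lemma least_model_exists (P : set (rule D S V B)) :
  program P -> exists I, least_model C P I.
Proof.
move=> progP.
exists [set phi | qc_fact phi /\ forall I, model C P I -> I phi].
have sub I : model C P I ->
  [set phi | qc_fact phi /\ forall I, model C P I -> I phi] `<=` I.
  by move=> mI phi [_]; exact.
split=> //; split; first split.
- by move=> phi [].
- by move=> phi qphi tphi; split=> // I [[_ + _] _]; exact.
- move=> phi phi' [_ Iphi] qphi' ent; split=> // I mI.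
  by case: (mI) => -[_ _ cl] _; exact: cl (Iphi I mI) qphi' ent.
- move=> R PR s Pi t d d0 ds hs hPi ht hd hd0 hds Hj H0 le0 lej; split.
    split=> //; exists (rar R), (rfun R), (fun i => esubst s (rlhs R i)).
    exists t, d, Pi; split=> // i.
    case: (progP _ PR) => /(_ i)[+ _] _ _ _ _.
    elim: (rlhs R i) => //= n [] //= c a IH ta j.
    by apply: IH; exact: ta.
  move=> I mI; case: (mI) => _ /(_ R PR); apply; try eassumption.
  + by move=> j; exact: iderives_mono (sub I mI) (Hj j).
  + exact: iderives_mono (sub I mI) H0.
Qed.

End Facts.

(* Main.v *)
(** The set M of derivable qc-facts is the least model.  It is below every
    model by soundness, because a fact derivable from an interpretation is
    entailed by one of its members.  It is a model because derivability is
    closed under entailment.  The delicate point there is that an instance of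
    an atomic constraint p(e) == X need not be atomic; but when its constraint
    set is satisfiable, radicality forces the value of X to be a variable, a
    basic value or a constant. *)
From mathcomp Require Import all_boot all_order.
From mathcomp Require Import boolp classical_sets functions cardinality.
Require Import Defs.
Import Order.TTheory.
Local Open Scope classical_set_scope.

Set Implicit Arguments.
Unset Strict Implicit.
Unset Printing Implicit Defensive.

(** * Information ordering, variables and substitution *)

Section Expressions.
Context {S : signature} {V : countType} {B : Type}.
Local Notation expr := (expr S V B).

Lemma ile_inv_right (e e' : expr) : ile e e' ->
  match e' with
  | App n h b => e = Bot \/ exists2 a, e = App h a & forall i, ile (a i) (b i)
  | _ => e = Bot \/ e = e'
  end.
Proof.
case: e => [|X|u|n h a].
- by case: e' => *; left.
- by move/ile_inv => ->; right.
- by move/ile_inv => ->; right.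
- by move/ile_inv => [b -> le]; right; exists a.
Qed.

Lemma ile_simple (t v : expr) : simple v -> ile t v -> t = Bot \/ t = v.
Proof.
case=> [X|u|c] /ile_inv_right //= [->|[a -> _]]; [by left|right].
by congr App; apply: funext => -[].
Qed.

Lemma vars_app n (h : symbol S n) (e : 'I_n -> expr) X :
  X \in vars (App h e) <-> exists i, X \in vars (e i).
Proof.
split=> /= [/flattenP[_ /mapP[i _ ->] Xi]|[i Xi]]; first by exists i.
by apply/flattenP; exists (vars (e i)) => //; apply/map_f; rewrite mem_enum.
Qed.

Lemma groundP (e : expr) : ground e <-> forall X, X \notin vars e.
Proof.
rewrite /ground; split=> [-> //|H].
by case: (vars e) H => // X s /(_ X); rewrite mem_head.
Qed.

Lemma vars_esubst s (e : expr) Y :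
  Y \in vars (esubst s e) <-> exists2 X, X \in vars e & Y \in vars (s X).
Proof.
elim: e => [|X|u|n h a IH]; only 1,3: by split=> // -[].
- split=> [Y_X|[_ /[!inE] /eqP ->] //]; by exists X => //; rewrite mem_head.
- split=> [/vars_app[i /IH[X Xi YX]]|[X /vars_app[i Xi] YX]].
    by exists X => //; apply/vars_app; exists i.
  by apply/vars_app; exists i; apply/IH; exists X.
Qed.

Lemma esubst_eq_in s s' (e : expr) :
  (forall X, X \in vars e -> s X = s' X) -> esubst s e = esubst s' e.
Proof.
elim: e => [|X|u|n h a IH] //= eq_s; first by apply: eq_s; rewrite mem_head.
congr App; apply: funext => i; apply: IH => X Xi; apply: eq_s.
by apply/(vars_app h); exists i.
Qed.

Lemma esubst_esubst s s' (e : expr) :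
  esubst s' (esubst s e) = esubst (fun X => esubst s' (s X)) e.
Proof. by elim: e => //= n h a IH; congr App; apply: funext => i. Qed.

Lemma esubst_id (e : expr) : esubst EVar e = e.
Proof. by elim: e => //= n h a IH; congr App; apply: funext => i. Qed.

Lemma is_term_esubst s (e : expr) :
  substitution s -> is_term e -> is_term (esubst s e).
Proof. by move=> ts; elim: e => //= n [] //= c a IH ta i; apply: IH. Qed.

Lemma gterm_esubst eta (e : expr) :
  is_term e -> (forall X, gterm (eta X)) -> gterm (esubst eta e).
Proof.
move=> te geta; split; first by apply: is_term_esubst => // X; case: (geta X).
apply/groundP => Y; apply/negP => /vars_esubst[X _].
by case: (geta X) => _ /groundP/(_ Y)/negbTE ->.
Qed.

(** Substitution keeps the root symbol and its arity, so an application becomes a constant only if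
    it already is one. *)
Lemma simple_esubst eta (v : expr) : is_term v ->
  [\/ esubst eta v = Bot, exists u, esubst eta v = EBas u
    | exists c : DC S 0, esubst eta v = cst c] ->
  v = Bot \/ simple v.
Proof.
case: v => [|X|u|n h a] tv; [by left| | |]; only 1,2: by right; constructor.
case=> [|[u]|[c' E]] //; right.
(* A match on the root extracts the equality of arities without inverting the dependent
   constructor. *)
have n0 : if esubst eta (App h a) is @App _ _ _ k _ _ then k = 0 else True.
  by rewrite E.
rewrite /= in n0; subst n; case: h tv E => // c _ _.
by have -> : a = (fun=> Bot); [apply: funext => -[]|exact: simple_cst].
Qed.

Lemma csubst_csubst s s' (pi : constraint S V B) :
  csubst s' (csubst s pi) = csubst (fun X => esubst s' (s X)) pi.
Proof.
rewrite /csubst /=; congr Constr; last exact: esubst_esubst.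
by apply: funext => i; exact: esubst_esubst.
Qed.

Lemma csubst_id (pi : constraint S V B) : csubst EVar pi = pi.
Proof.
case: pi => n p e v; rewrite /csubst /= esubst_id; congr Constr.
by apply: funext => i; exact: esubst_id.
Qed.

Lemma csubst_eq_in s s' (pi : constraint S V B) :
  (forall X, cvars pi X -> s X = s' X) -> csubst s pi = csubst s' pi.
Proof.
move=> eq_s; congr Constr; [apply: funext => i|];
  apply: esubst_eq_in => X Xi; apply: eq_s; by [left; exists i|right].
Qed.

Lemma cvars_csubst_ground eta (pi : constraint S V B) X :
  cground (csubst eta pi) -> cvars pi X -> ground (eta X).
Proof.
move=> g Xpi; apply/groundP => Y; apply/negP => YX.
suff : cvars (csubst eta pi) Y by rewrite g.
by case: Xpi => [[i Xi]|Xr]; [left; exists i|right]; apply/vars_esubst; exists X.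
Qed.

(** * Solutions and constraint entailment under substitution *)

Variable C : cdomain S V B.

Lemma gterm_valuation (eta : V -> expr) :
  (forall X, gterm (eta X)) -> valuation eta /\ vdom eta = setT.
Proof.
move=> geta; split; first by split=> // X; case: (geta X).
apply/seteqP; split=> // X _ E; case: (geta X) => _.
by rewrite E.
Qed.

Lemma Sol_vdom Pi eta : Sol C Pi eta -> csvars Pi `<=` vdom eta.
Proof.
move=> [_ sol] X [pi /sol[g _] Xpi] E.
by have := cvars_csubst_ground g Xpi; rewrite E.
Qed.

Lemma Sol_eq_in Pi eta eta' : valuation eta' ->
  (forall X, csvars Pi X -> eta X = eta' X) -> Sol C Pi eta -> Sol C Pi eta'.
Proof.
move=> veta' eq_eta [_ sol]; split=> // pi Pipi.
rewrite -(@csubst_eq_in eta eta'); first exact: sol.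
by move=> X Xpi; apply: eq_eta; exists pi.
Qed.

Lemma Sol_csubst s Pi eta : substitution s -> (forall X, gterm (eta X)) ->
  Sol C (csubst s @` Pi) eta -> Sol C Pi (fun X => esubst eta (s X)).
Proof.
move=> ts geta [_ sol]; split.
  by apply: (gterm_valuation _).1 => X; exact: gterm_esubst.
by move=> pi Pipi; rewrite -csubst_csubst; apply: sol; exists pi.
Qed.

(* The entailment [models_cs] only speaks of valuations defined on the
   variables of both sides, hence the completion of [eta]. *)
Lemma models_cs_Sol s Pi Pi' eta :
  substitution s -> models_cs C Pi' (csubst s @` Pi) -> Sol C Pi' eta ->
  exists eta', [/\ forall X, gterm (eta' X), {in vdom eta, eta =1 eta'} &
                   Sol C Pi (fun X => esubst eta' (s X))].
Proof.
move=> ts hmod sol; pose eta' X := if pselect (vdom eta X) then eta X else Bot.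
have geta' X : gterm (eta' X).
  by rewrite /eta'; case: pselect => // ?; case: sol => -[_ geta] _; exact: geta.
have eq_eta : {in vdom eta, eta =1 eta'}.
  by move=> X; rewrite inE /eta' => ?; case: pselect.
have [veta' dom] := gterm_valuation geta'.
exists eta'; split=> //; apply: Sol_csubst => //.
have sol' : Sol C Pi' eta'.
  apply: (Sol_eq_in veta' _ sol) => X Xpi; apply: eq_eta; rewrite inE.
  exact: Sol_vdom sol _ Xpi.
split=> // pi Pipi.
have [|_ /(_ pi)] := hmod eta' veta' _ sol' pi Pipi; first by rewrite dom.
by apply.
Qed.

Lemma models_cs_sat s Pi Pi' :
  substitution s -> models_cs C Pi' (csubst s @` Pi) ->
  ~ Unsat C Pi' -> ~ Unsat C Pi.
Proof.
move=> ts hmod /eqP/set0P[eta sol].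
have [eta' [_ _ sol']] := models_cs_Sol ts hmod sol.
by apply/eqP/set0P; exists (fun X => esubst eta' (s X)).
Qed.

Lemma models_cs_refl Pi : models_cs C Pi (csubst EVar @` Pi).
Proof.
move=> eta veta _ [_ sol] _ [pi Pipi <-]; split=> // _ ->.
by rewrite csubst_id; exact: sol.
Qed.

(** The premise is evaluated at [s] followed by a completion of [eta] that is ground everywhere. The
    completion agrees with [eta] on the variables of the conclusion, since these lie in
    [vdom eta]. *)
Lemma models_prod_csubst s Pi Pi' n (p : PF S n) t v :
  substitution s -> models_cs C Pi' (csubst s @` Pi) ->
  models_prod C Pi p t v ->
  models_prod C Pi' p (fun i => esubst s (t i)) (esubst s v).
Proof.
move=> ts hmod modp eta veta dom sol.
have [eta' [geta' eq_eta sol']] := models_cs_Sol ts hmod sol.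
have E (e : expr) : (forall X, X \in vars e -> vdom eta X) ->
    esubst eta e = esubst eta' e.
  by move=> sub; apply: esubst_eq_in => X /sub ?; apply: eq_eta; rewrite inE.
have -> : (fun i => esubst eta (esubst s (t i))) =
    fun i => esubst (fun X => esubst eta' (s X)) (t i).
  apply: funext => i; rewrite -esubst_esubst E // => X Xi.
  by apply: dom; right; left; exists i.
rewrite E; last by move=> X Xv; apply: dom; right; right.
have [|veta'' dom''] := @gterm_valuation (fun X => esubst eta' (s X)).
  by move=> X; exact: gterm_esubst.
by rewrite esubst_esubst; apply: modp => //; rewrite dom''.
Qed.

Lemma models_constr_csubst s Pi Pi' pi :
  substitution s -> models_cs C Pi' (csubst s @` Pi) ->
  models_cs C Pi [set pi] -> models_cs C Pi' [set csubst s pi].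
Proof.
move=> ts hmod modp eta veta dom sol _ ->; split=> // _ ->.
have [eta' [geta' eq_eta sol']] := models_cs_Sol ts hmod sol.
have -> : csubst eta (csubst s pi) = csubst eta' (csubst s pi).
  apply: csubst_eq_in => X Xpi; apply: eq_eta; rewrite inE.
  by apply: dom; right; exists (csubst s pi).
have [|veta'' dom''] := @gterm_valuation (fun X => esubst eta' (s X)).
  by move=> X; exact: gterm_esubst.
rewrite csubst_csubst.
have [|_ /(_ pi)] := modp _ veta'' _ sol' pi erefl; first by rewrite dom''.
by apply.
Qed.

Lemma sat_total Pi : ~ Unsat C Pi ->
  exists2 eta : V -> expr, forall X, gterm (eta X) & Sol C Pi eta.
Proof.
move=> /eqP/set0P[eta sol].
have [|eta' [geta' _ sol']] := models_cs_Sol _ (@models_cs_refl Pi) sol.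
  by [].
by exists eta'.
Qed.

(** A single solution suffices: the value of [v] at it is radical, and [simple_esubst] pulls that
    shape back to [v]. *)
Lemma models_prod_simple Pi n (p : PF S n) t v : ~ Unsat C Pi ->
  is_term v -> models_prod C Pi p t v -> v = Bot \/ simple v.
Proof.
move=> /sat_total[eta geta sol] tv hmod; apply: (@simple_esubst eta) => //.
have [veta dom] := gterm_valuation geta.
by apply: (interp_radical (hmod eta veta _ sol)); rewrite dom.
Qed.

(** The first alternative arises because [red_bot] also applies to primitive calls. *)
Lemma reduces_pri_inv (e v : expr) : reduces C e v ->
  if e is App n (Spri p) _ then v = Bot \/ exists t, interp C p t v else True.
Proof.
case=> {e v} // [e _ _|n p e t v _ pv]; last by right; exists t.
by case: e => // n [] // p e; left.
Qed.

Lemma models_constr_simple Pi n (p : PF S n) t v : ~ Unsat C Pi ->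
  is_term v -> models_cs C Pi [set Constr p t v] -> simple v.
Proof.
move=> /sat_total[eta geta sol] tv hmod.
have [veta dom] := gterm_valuation geta.
have [|_ /(_ _ erefl)[_ [/= tot red]]] := hmod eta veta _ sol _ erefl.
  by rewrite dom.
(* [holds] demands a total right-hand side, which rules out [Bot]. *)
have [E|//] : v = Bot \/ simple v; last by rewrite E in tot.
apply: (@simple_esubst eta) => //.
have [E|[t' /interp_radical//]] := reduces_pri_inv red.
by rewrite E in tot.
Qed.

End Expressions.

(** * Inversion of derivations and soundness *)

Section Logics.
Context {S : signature} {V : countType} {B : Type}.
Context {disp : Order.disp_t} {D : qdomain disp} {C : cdomain S V B}.
Local Notation statement := (statement D S V B).
Local Notation rule := (rule D S V B).

Lemma derives_qc (P : set rule) phi : derives C P phi -> qc_statement phi.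
Proof.
by case=> {phi} // *; match goal with H : nontrivial _ _ |- _ => case: H end.
Qed.

(** Only QTI, QRR and QDC can conclude a production from a term, and for satisfiable [Pi] each
    yields an approximation of that term. *)
Lemma iderives_term (I : set statement) phi : iderives C I phi ->
  if phi is Prod e t _ Pi then is_term e -> ~ Unsat C Pi -> ile t e else True.
Proof.
elim=> {phi} // [[e t d Pi|//] _ [->|//]| | |n c e t ds d Pi _ _ IH _ te sat].
- by move=> *; exact: ile_bot.
- by move=> *; exact: ile_refl.
- by move=> *; exact: ile_refl.
- by apply: ile_app => i; exact: IH.
Qed.

Lemma iderives_def_inv (I : set statement) phi : iderives C I phi ->
  if phi is Prod (App n (Sdef f) e) t' d Pi then
    trivial_stmt C phi \/ exists t d0 ds,
      [/\ forall i, iderives C I (Prod (e i) (t i) (ds i) Pi),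
          I (Prod (def f t) t' d0 Pi) & (d <= d0)%O]
  else True.
Proof.
case=> {phi} //.
- by case=> // -[] // n [] // f e t d Pi _ ?; left.
- by move=> n f e t t' d0 ds d Pi _ ? ? _ ? _; right; exists t, d0, ds.
Qed.

Lemma derives_def_inv (P : set rule) phi : derives C P phi ->
  if phi is Prod (App n (Sdef f) e) t' d Pi then
    trivial_stmt C phi \/
    exists t alpha r m (delta : 'I_m -> constraint S V B) ds d0' ds',
      [/\ forall i, derives C P (Prod (e i) (t i) (ds i) Pi),
          derives C P (Prod r t' d0' Pi) /\
            (forall j, derives C P (Atom (delta j) (ds' j) Pi)),
          instances P (Rule f t alpha r delta),
          (d <= qop alpha d0')%O & forall j, (d <= qop alpha (ds' j))%O]
  else True.
Proof.
case=> {phi} //.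
- by case=> // -[] // n [] // f e t d Pi _ ?; left.
- move=> n f e t t' alpha r m delta ds d0' ds' d Pi *; right.
  by exists t, alpha, r, m, delta, ds, d0', ds'.
Qed.

Lemma model_instance (P : set rule) (I : set statement) R t d0
    (ds : 'I_(rlen R) -> D) d Pi :
  model C P I -> instances P R ->
  nontrivial C (Prod (def (rfun R) (rlhs R)) t d Pi) ->
  iderives C I (Prod (rrhs R) t d0 Pi) -> d0 != \bot%O ->
  (forall j, iderives C I (Atom (rcond R j) (ds j) Pi)) ->
  (forall j, ds j != \bot%O) ->
  (d <= qop (ratt R) d0)%O -> (forall j, d <= qop (ratt R) (ds j))%O ->
  I (Prod (def (rfun R) (rlhs R)) t d Pi).
Proof.
move=> [_ mI] [R0 [s [PR0 ts E]]]; subst R => -[[tt hd hPi] _] *.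
by apply: (mI R0 PR0 s Pi t d d0 ds).
Qed.

(** A [QDF] step is replayed by [IQDF]: the model condition on the rule instance puts the required
    fact into [I], with qualification [d] itself. *)
Theorem soundness (P : set rule) phi : derives C P phi -> consequence C P phi.
Proof.
move=> der I mI; elim: der => {phi}.
- by move=> *; exact: IQTI.
- by move=> *; exact: IQRR_var.
- by move=> *; exact: IQRR_bas.
- by move=> *; apply: IQDC; eassumption.
- move=> n f e t t' alpha r m delta ds d0' ds' d Pi nt _ IHe
    /derives_qc[_ hd0' _] IHr hdel IHd inst led le0 led'.
  have nt' : nontrivial C (Prod (def f t) t' d Pi) by case: nt.
  apply: (@IQDF _ _ _ _ _ _ _ _ f e t t' d ds) => //.
  apply: (@model_instance P I (Rule f t alpha r delta) t' d0' ds') => //= j.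
  by case: (derives_qc (hdel j)).
- by move=> *; apply: IQPF; eassumption.
- by move=> *; apply: IQAC; eassumption.
Qed.

(** * Closure of derivability under entailment *)

(** The derivation follows the structure of [t]: QTI at [Bot], QRR at the other leaves, QDC at
    constructors. Parts of [e] above a [Bot] are never inspected. *)
Lemma derives_ile (P : set rule) e t d Pi : constraint_set Pi -> d != \bot%O ->
  is_term t -> ile t e -> derives C P (Prod e t d Pi).
Proof.
move=> hPi hd; have [uPi|sPi] := pselect (Unsat C Pi).
  by move=> tt _; apply: QTI => //; right.
elim: t e => [|X|u|n h a IH] e tt /ile_inv.
- by move=> _; apply: QTI => //; left.
- by move=> ->; apply: QRR_var; split=> // -[].
- by move=> ->; apply: QRR_bas; split=> // -[].
- move=> [b -> le]; case: h tt => // c tt.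
  apply: (@QDC _ _ _ _ _ _ _ _ c b a (fun=> d)) => // [|i].
    by split=> // -[].
  by apply: IH => //; exact: tt.
Qed.

Lemma rsubst_rsubst s s' (R : rule) :
  rsubst s' (rsubst s R) = rsubst (fun X => esubst s' (s X)) R.
Proof.
rewrite /rsubst /= esubst_esubst.
rewrite (funext (fun i => esubst_esubst s s' (rlhs R i))).
by rewrite (funext (fun j => csubst_csubst s s' (rcond R j))).
Qed.

Lemma instances_rsubst (P : set rule) s R :
  substitution s -> instances P R -> instances P (rsubst s R).
Proof.
move=> ts [R0 [s0 [PR0 ts0 ->]]]; exists R0, (fun X => esubst s (s0 X)).
by split=> // [X|]; [exact: is_term_esubst|exact: rsubst_rsubst].
Qed.

(** Both sides of a production may move along [ile], as in entailment of facts. An atom occurs only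
    as a condition of a rule instance, so its exact instance is enough; that this instance is again
    atomic is part of the conclusion and rests on [Pi'] being satisfiable. *)
Lemma derives_csubst (P : set rule) s phi : substitution s -> derives C P phi ->
  match phi with
  | Prod e t d Pi => forall e' t' d' Pi', qc_statement (Prod e' t' d' Pi') ->
      ~ Unsat C Pi' -> models_cs C Pi' (csubst s @` Pi) -> (d' <= d)%O ->
      ile (esubst s e) e' -> ile t' (esubst s t) ->
      derives C P (Prod e' t' d' Pi')
  | Atom delta d Pi => forall d' Pi', d' != \bot%O -> constraint_set Pi' ->
      ~ Unsat C Pi' -> models_cs C Pi' (csubst s @` Pi) -> (d' <= d)%O ->
      derives C P (Atom (csubst s delta) d' Pi')
  end.
Proof.
move=> ts; have bot e d Pi : qc_statement (Prod e Bot d Pi) ->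
    derives C P (Prod e Bot d Pi).
  by move=> ?; apply: QTI => //; left.
elim=> {phi}.
- case=> [e t d Pi|delta d Pi] _ /= => [[->|uPi]|uPi].
  + by move=> e' t' d' Pi' qc _ _ _ _ /ile_inv_right[] E; subst t'; exact: bot.
  + by move=> e' t' d' Pi' _ sat /(models_cs_sat ts)-/(_ sat).
  + by move=> d' Pi' _ _ sat /(models_cs_sat ts)-/(_ sat).
(* [s X] may be any term, so QRR may no longer apply; still, [t'] lies below [s X] and hence below
   [e']. *)
- move=> X d Pi _ e' t' d' Pi' [tt' hd hPi] _ _ _ le1 le2.
  by apply: derives_ile => //; exact: ile_trans le1.
- move=> u d Pi _ e' t' d' Pi' [tt' hd hPi] _ _ _ le1 le2.
  by apply: derives_ile => //; exact: ile_trans le1.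
- move=> n c e t ds d Pi _ _ IH led e' t' d' Pi' qc sat hmod led' /ile_inv[b -> le].
  move=> /ile_inv_right[E|[a E le2]]; subst t'; first exact: bot.
  have [tt' hd hPi] := qc.
  apply: (@QDC _ _ _ _ _ _ _ _ c b a (fun=> d')) => // [|i].
    by split=> // -[].
  by apply: (IH i) => //; exact: le_trans (led i).
- move=> n f e t t0 alpha r m delta ds d0 ds' d Pi _ Hi IHe Hr IHr Hd IHd inst.
  move=> led le0 lej e' t' d' Pi' qc sat hmod led' /ile_inv[b -> le] le2.
  have [t'bot|t'bot] := pselect (t' = Bot).
    by subst t'; exact: bot.
  have [tt' hd hPi] := qc.
  (* The rule instance is instantiated once more by [s]. Argument premises are weakened to [d']; the
     body and the conditions keep their qualifications. *)
  apply: (@QDF _ _ _ _ _ _ _ _ f b (fun i => esubst s (t i)) t' alpha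
     (esubst s r) m (fun j => csubst s (delta j)) (fun=> d') d0 ds') => //.
  + by split=> // -[].
  + move=> i; apply: (IHe i) => //; last 1 first.
    * exact: ile_refl.
    * by have [/is_term_esubst-/(_ _ ts)] := derives_qc (Hi i).
    * exact: le_trans (led i).
  + apply: IHr => //; last exact: ile_refl.
    by have [] := derives_qc Hr.
  + by move=> j; apply: IHd => //; have [] := derives_qc (Hd j).
  + exact: (instances_rsubst ts inst).
  + exact: le_trans led' le0.
  + by move=> j; exact: le_trans led' (lej j).
- move=> n p e t v ds d Pi nt Hi IH sv hmod led e' t' d' Pi' qc sat hmod' led'.
  move=> /ile_inv[b -> le] le2.
  have [t'bot|t'bot] := pselect (t' = Bot).
    by subst t'; exact: bot.
  have [[tv _ _] _] := nt; have [tt' hd hPi] := qc.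
  have modv := models_prod_csubst ts hmod' hmod.
  have sv' : simple (esubst s v).
    (* If the instance of [v] were [Bot], then [t'] below it would be [Bot] too, a case already
       settled. *)
    have [E|//] := models_prod_simple sat (is_term_esubst ts tv) modv.
    by move: le2; rewrite E => /ile_inv_right[].
  have [//|E] := ile_simple sv' le2; subst t'.
  apply: (@QPF _ _ _ _ _ _ _ _ p b (fun i => esubst s (t i)) _ (fun=> d')) => //.
    by split=> // -[].
  move=> i; apply: (IH i) => //; last 1 first.
  + exact: ile_refl.
  + by have [/is_term_esubst-/(_ _ ts)] := derives_qc (Hi i).
  + exact: le_trans (led i).
- move=> n p e t v ds d Pi nt Hi IH sv hmod led d' Pi' hd hPi sat hmod' led'.
  have modv := models_constr_csubst ts hmod' hmod.
  have tv : is_term v by case: sv.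
  have sv' : simple (esubst s v).
    exact: models_constr_simple sat (is_term_esubst ts tv) modv.
  apply: (@QAC _ _ _ _ _ _ _ _ p _ (fun i => esubst s (t i)) _ (fun=> d')) => //.
  move=> i; apply: (IH i) => //; last 2 first.
  + exact: ile_refl.
  + exact: ile_refl.
  + by have [/is_term_esubst-/(_ _ ts)] := derives_qc (Hi i).
  + exact: le_trans (led i).
Qed.

Lemma derives_entails (P : set rule) phi phi' : qc_fact phi' ->
  entails C phi phi' -> derives C P phi -> derives C P phi'.
Proof.
move=> [qc [n [f [u [t' [d' [Pi' [E _]]]]]]]]; subst phi'.
case: phi => // e t d Pi [s [ts hmod led le1 le2]] der.
have [uPi|sat] := pselect (Unsat C Pi'); first by apply: QTI => //; right.
by have /(_ _ _ _ _ qc sat hmod) := derives_csubst ts der; exact.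
Qed.

(** * The derivable facts form the least model *)

Section Program.
Context {P : set rule} (progP : program P).

Let derivable := [set phi | qc_fact phi /\ derives C P phi].

(** Transferred from [iderives_term] by soundness in some model, which exists because [P] is a
    program. *)
Lemma derives_term e t d Pi :
  derives C P (Prod e t d Pi) -> is_term e -> ~ Unsat C Pi -> ile t e.
Proof.
have [I [mI _]] := least_model_exists C progP.
by move=> /soundness/(_ I mI)/iderives_term.
Qed.

(** In an [IQDF] step the fact with arguments [t] was itself derived, through a rule instance with
    arguments [u] such that each [t i] produces [u i]. As the [t i] are terms, [u i] lies below
    [t i]; so the derivations into [t i] weaken to derivations into [u i], and [QDF] applies with
    the same instance. *)
Lemma iderives_derives phi : iderives C derivable phi -> derives C P phi.
Proof.
elim=> {phi}.
- by move=> *; exact: QTI.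
- by move=> *; exact: QRR_var.
- by move=> *; exact: QRR_bas.
- by move=> *; apply: QDC; eassumption.
- move=> n f e t t' d0 ds d Pi nt _ IH [[_ fact] der] [_ ntf] led0 led.
  have [//|] := derives_def_inv der.
  move=> [u [alpha [r [m [delta [ds1 [d1 [ds2 [Hi [Hr Hd] inst le1 le2]]]]]]]]].
  have tt i : is_term (t i) by case: (derives_qc (IH i)).
  have [[_ hd hPi] _] := nt.
  have sat : ~ Unsat C Pi by move=> U; case: ntf; right.
  apply: (@QDF _ _ _ _ _ _ _ _ f e u t' alpha r m delta (fun=> d) d1 ds2) => //.
  + move=> i; have tu : is_term (u i) by case: (derives_qc (Hi i)).
    have := @derives_csubst P EVar _ (fun=> I) (IH i); apply=> //.
    * exact: models_cs_refl.
    * by rewrite esubst_id; exact: ile_refl.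
    * rewrite esubst_id; exact: derives_term (Hi i) (tt i) sat.
  + exact: le_trans le1.
  + by move=> j; exact: le_trans (le2 j).
- by move=> *; apply: QPF; eassumption.
- by move=> *; apply: QAC; eassumption.
Qed.

Lemma model_derivable : model C P derivable.
Proof.
split; first split.
- by move=> phi [].
- by move=> phi fact triv; split=> //; apply: QTI => //; case: fact.
- by move=> phi phi' [_ der] fact ent; split=> //; exact: derives_entails der.
- move=> R PR s Pi t d d0 ds ts hPi tt hd hd0 hds Hd Hr le0 led.
  have tl i : is_term (esubst s (rlhs R i)).
    by apply: is_term_esubst => //; have [/(_ i)[]] := progP PR.
  split; first by split=> //; do 6 eexists; split; first by [].
  set phi := Prod _ _ _ _.
  have [triv|ntriv] := pselect (trivial_stmt C phi); first exact: QTI.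
  (* The instantiated left-hand side serves both as arguments and as pattern, so the argument
     premises are reflexive. *)
  apply: (@QDF _ _ _ _ _ _ _ _ (rfun R) _ (fun i => esubst s (rlhs R i)) t
    (ratt R) (esubst s (rrhs R)) (rlen R) (fun j => csubst s (rcond R j))
    (fun=> d) d0 ds) => //.
  + by move=> i; apply: derives_ile => //; exact: ile_refl.
  + exact: iderives_derives.
  + by move=> j; exact: iderives_derives.
  + by exists R, s.
Qed.

(** By soundness the fact is derivable from [I]. Inversion gives a member of [I] whose arguments
    approximate those of the fact, so it entails the fact by the identity substitution. *)
Lemma derivable_model I phi : model C P I -> qc_fact phi -> derives C P phi -> I phi.
Proof.
move=> mI fact der; have [[_ triv ent] _] := mI.
have [?|nt] := pselect (trivial_stmt C phi); first exact: triv.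
have := soundness der mI; have [qc [n [f [t [t' [d [Pi [E tt]]]]]]]] := fact.
subst phi => /iderives_def_inv[//|[u [d0 [ds [Hi Iu led]]]]].
apply: ent Iu fact _; exists EVar; split=> //.
- exact: models_cs_refl.
- rewrite esubst_id; apply: ile_app => i.
  by apply: iderives_term (Hi i) (tt i) _ => U; case: nt; right.
- by rewrite esubst_id; exact: ile_refl.
Qed.

Theorem canonicity SP : least_model C P SP -> SP = derivable.
Proof.
move=> [mSP leSP]; apply/seteqP; split; first exact: leSP model_derivable.
by move=> phi [fact der]; exact: derivable_model.
Qed.

End Program.
End Logics.

Theorem theorem2 (disp : Order.disp_t) (D : qdomain disp)
    (S : signature) (V : countType) (hV : infinite_set [set: V]) (B : Type)
    (C : cdomain S V B) (hexp : expressible D C)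
    (P : set (rule D S V B)) (hP : program P)
    (SP : set (statement D S V B)) (hSP : least_model C P SP) :
  (forall phi : statement D S V B, qc_statement phi ->
     [<-> derives C P phi;
          consequence C P phi;
          iderives C SP phi])
  /\ (forall phi : statement D S V B, qc_statement phi ->
        derives C P phi -> consequence C P phi)
  /\ (forall phi : statement D S V B, qc_statement phi ->
        consequence C P phi -> derives C P phi)
  /\ SP = [set phi : statement D S V B | qc_fact phi /\ derives C P phi].
Proof.
have canon := canonicity hP hSP; have [mSP _] := hSP.
(* The consequence is tested only in the model [SP], whose members are exactly the derivable
   facts. *)
have complete phi : consequence C P phi -> derives C P phi.
  by move=> /(_ SP mSP); rewrite canon; exact: iderives_derives.
split; last by split=> [phi _ /soundness|]; [|split=> // phi _; exact: complete].
move=> phi _; tfae; [exact: soundness|by move=> /(_ SP mSP)|].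
by rewrite canon; exact: iderives_derives.
Qed.
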